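(* Let $G$ be a finite simple graph with $n=|V(G)|$, and let $T(G)$ be the graph obtained from $G$ by adding, for every vertex $v\in V(G)$, new vertices $a^v,b^v,c^v,d^v_i,e^v_i$ ($1\le i\le 2n+1$) and new edges $va^v$, $a^vb^v$, $vc^v$, $c^vd^v_i$, $d^v_ie^v_i$ ($1\le i\le 2n+1$). Then $\sigma(T(G))=2n-\alpha(G)$.
   Context: $\sigma(H)$ denotes the minimum cardinality of a maximal induced matching in $H$, where an induced matching (distance-2 matching) is a set of edges such that for any two distinct edges $e_1,e_2$ of the set, no endpoint of $e_1$ equals or is adjacent to an endpoint of $e_2$, and maximal means not contained in a larger induced matching. $\alpha(G)$ is the maximum size of an independent set in $G$. *)

(* Defs.v *)
From HB Require Import structures.
From mathcomp Require Import all_boot.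

Set Implicit Arguments.
Unset Strict Implicit.
Unset Printing Implicit Defensive.

Record sgraph := SGraph {
  vertex :> finType;
  adj : rel vertex;
  adj_sym : symmetric adj;
  adj_irrefl : irreflexive adj }.

Section Invariants.
Variable H : sgraph.
Implicit Types (S : {set H}) (M : {set {set H}}).

Definition edges : {set {set H}} :=
  [set [set x; y] | x in H, y in adj x].

Definition independent S : bool :=
  [forall x in S, forall y in S, ~~ adj x y].

(* Independence number. *)
Definition alpha : nat := \max_(S : {set H} | independent S) #|S|.

Definition induced_matching M : bool :=
  (M \subset edges) &&
  [forall e1 in M, forall e2 in M, (e1 != e2) ==>
    [forall x in e1, forall y in e2, (x != y) && ~~ adj x y]].

Definition maximal_induced_matching M : bool := maxset induced_matching M.

Lemma maximal_induced_matching_size_ex :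
  exists k, [exists M, maximal_induced_matching M && (#|M| == k)].
Proof.
have im0 : induced_matching set0.
  by rewrite /induced_matching sub0set; apply/forall_inP => e1; rewrite inE.
have [M maxM _] := maxset_exists im0.
by exists #|M|; apply/existsP; exists M; rewrite eqxx andbT.
Qed.

(* Minimum cardinality of a maximal induced matching. *)
Definition sigma : nat := ex_minn maximal_induced_matching_size_ex.

End Invariants.

Section Construction.
Variable G : sgraph.

Let idx := 'I_(2 * #|G| + 1).

Inductive T_vertex :=
  | Tv of G
  | Ta of G
  | Tb of G
  | Tc of G
  | Td of G & idx
  | Te of G & idx.

Definition T_vertex_code (x : T_vertex) : G + G + G + G + G * idx + G * idx :=
  match x with
  | Tv v => inl (inl (inl (inl (inl v))))
  | Ta v => inl (inl (inl (inl (inr v))))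
  | Tb v => inl (inl (inl (inr v)))
  | Tc v => inl (inl (inr v))
  | Td v i => inl (inr (v, i))
  | Te v i => inr (v, i)
  end.

Definition T_vertex_decode (s : G + G + G + G + G * idx + G * idx) : T_vertex :=
  match s with
  | inl (inl (inl (inl (inl v)))) => Tv v
  | inl (inl (inl (inl (inr v)))) => Ta v
  | inl (inl (inl (inr v))) => Tb v
  | inl (inl (inr v)) => Tc v
  | inl (inr (v, i)) => Td v i
  | inr (v, i) => Te v i
  end.

Lemma T_vertex_codeK : cancel T_vertex_code T_vertex_decode.
Proof. by case. Qed.

HB.instance Definition _ := Finite.copy T_vertex (can_type T_vertex_codeK).

(* New edges are listed in one orientation only; T_adj symmetrizes. *)
Definition T_arc (x y : T_vertex) : bool :=
  match x, y with
  | Tv u, Tv v => adj u v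
  | Tv u, Ta v => u == v
  | Ta u, Tb v => u == v
  | Tv u, Tc v => u == v
  | Tc u, Td v _ => u == v
  | Td u i, Te v j => (u == v) && (i == j)
  | _, _ => false
  end.

Definition T_adj (x y : T_vertex) : bool := T_arc x y || T_arc y x.

Lemma T_adj_sym : symmetric T_adj.
Proof. by move=> x y; rewrite /T_adj orbC. Qed.

Lemma T_adj_irrefl : irreflexive T_adj.
Proof. by case=> //= v; rewrite /T_adj /= adj_irrefl. Qed.

Definition T_graph : sgraph := SGraph T_adj_sym T_adj_irrefl.

End Construction.

(* Main.v *)
(** In the gadget of [v], a maximal induced matching [M] must cover [c^v]:
    otherwise it has to contain all the edges [d^v_i e^v_i], of which there are
    more than [2n].  If [c^v] is matched to [v], nothing more is needed in the
    gadget, and the set [I] of these [v] is independent; if [c^v] is matched to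
    some [d^v_i], then [v] is uncovered and the edge [a^v b^v] is forced.  Hence
    [M] has [n + (n - |I|)] edges.  Conversely every independent set [I] of [G]
    arises in this way from a maximal induced matching. *)
Require Import Defs.
From mathcomp Require Import all_boot.

Set Implicit Arguments.
Unset Strict Implicit.
Unset Printing Implicit Defensive.

(** * Induced matchings, their covered vertices, and domination in an arbitrary graph *)

Section InducedMatchings.
Variable H : sgraph.
Implicit Types (x y z : H) (S W : {set H}) (M : {set {set H}}).

Lemma edgesP (e : {set H}) :
  reflect (exists x y, adj x y /\ e = [set x; y]) (e \in edges H).
Proof.
apply: (iffP imset2P) => [[x y _ xy ->]|[x [y [xy ->]]]].
  by exists x, y; split=> //; move: xy; rewrite unfold_in.
by exists x y.
Qed.

Lemma mem_edges x y : adj x y -> [set x; y] \in edges H.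
Proof. by move=> xy; apply/edgesP; exists x, y. Qed.

Lemma edge_adj (e : {set H}) x y :
  e \in edges H -> x \in e -> y \in e -> x != y -> adj x y /\ e = [set x; y].
Proof.
move=> /edgesP[p [q [pq ->]]]; rewrite !inE.
case/orP=> /eqP-> /orP[] /eqP->; rewrite ?eqxx // => _.
by split; [rewrite adj_sym | rewrite setUC].
Qed.

Lemma independentP S :
  reflect {in S &, forall x y, ~~ adj x y} (independent S).
Proof.
apply: (iffP forall_inP) => [h x y xS yS|h x xS].
  exact: (forall_inP (h x xS)).
by apply/forall_inP => y yS; apply: h.
Qed.

Lemma induced_matchingP M :
  reflect (M \subset edges H /\
           forall e1 e2 x y, e1 \in M -> e2 \in M -> x \in e1 -> y \in e2 ->
             (x == y) || adj x y -> e1 = e2)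
          (induced_matching M).
Proof.
apply: (iffP andP) => -[sM h]; split=> //.
  move=> e1 e2 x y e1M e2M xe ye xy; apply/eqP/negPn/negP => ne.
  move: (forall_inP (implyP (forall_inP (forall_inP h _ e1M) _ e2M) ne) _ xe).
  by move=> /forall_inP/(_ _ ye); rewrite -negb_or xy.
apply/forall_inP => e1 e1M; apply/forall_inP => e2 e2M; apply/implyP => ne.
apply/forall_inP => x xe; apply/forall_inP => y ye; rewrite -negb_or.
by apply: contra ne => /(h _ _ _ _ e1M e2M xe ye) ->.
Qed.

Lemma induced_matching_edge M x y : induced_matching M ->
  x \in cover M -> y \in cover M -> adj x y -> [set x; y] \in M.
Proof.
case/induced_matchingP=> sM h /bigcupP[e1 e1M xe] /bigcupP[e2 e2M ye] xy.
have e12 : e1 = e2 by apply: h e1M e2M xe ye _; rewrite xy orbT.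
subst e2.
have nxy : x != y by apply: contraTneq xy => ->; rewrite adj_irrefl.
by have [_ <-] := edge_adj (subsetP sM _ e1M) xe ye nxy.
Qed.

Lemma cover_neighbour M x : M \subset edges H -> x \in cover M ->
  exists2 y, adj x y & y \in cover M.
Proof.
move=> sM /bigcupP[e eM]; have /edgesP[p [q [pq de]]] := subsetP sM _ eM.
have eW z : z \in e -> z \in cover M by move=> ze; apply/bigcupP; exists e.
rewrite de !inE => /orP[] /eqP->; [exists q => // | exists p; rewrite 1?adj_sym //].
  by apply: eW; rewrite de set22.
by apply: eW; rewrite de set21.
Qed.

Definition dominated W x := [exists z in W, (z == x) || adj z x].

Lemma dominatedI W x z : z \in W -> (z == x) || adj z x -> dominated W x.
Proof. by move=> zW zx; apply/exists_inP; exists z. Qed.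

(** If neither end of the edge were in the closed neighbourhood of [cover M], the edge could be
    added to [M]. By maximality it would then already be in [M], so that [x] would be covered and
    hence dominated. *)
Lemma maximal_dominating M x y : maximal_induced_matching M -> adj x y ->
  dominated (cover M) x || dominated (cover M) y.
Proof.
move=> /maxsetP[iM maxM] xy; have [sM h] := induced_matchingP _ iM.
apply: contraT; rewrite negb_or => /andP[ndx ndy].
have nz e z t : e \in M -> z \in e -> t \in [set x; y] ->
    ~~ ((z == t) || adj z t).
  move=> eM ze txy; apply/negP => zt.
  have zM : z \in cover M by apply/bigcupP; exists e.
  move: txy; rewrite !inE => /orP[] /eqP tE; subst t.
    by rewrite (dominatedI zM zt) in ndx.
  by rewrite (dominatedI zM zt) in ndy.
have xyM : [set x; y] \in M.
  rewrite -(maxM ([set x; y] |: M)) ?subsetUr ?setU11 //.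
  apply/induced_matchingP; split.
    by rewrite subUset sM andbT sub1set mem_edges.
  move=> e1 e2 z t; rewrite 2!in_setU1.
  move=> /orP[/eqP->|e1M] /orP[/eqP->|e2M] // ze te zt.
  - by have := nz _ _ _ e2M te ze; rewrite eq_sym adj_sym zt.
  - by have := nz _ _ _ e1M ze te; rewrite zt.
  - exact: h e1M e2M ze te zt.
by have := nz _ x x xyM; rewrite !inE !eqxx => /(_ isT isT).
Qed.

(** Converse of [maximal_dominating]: an edge of a larger induced matching [N] has an end dominated
    by some edge of [M]. Both edges are in [N], so they coincide. *)
Lemma dominating_maximal M : induced_matching M ->
  (forall x y, adj x y -> dominated (cover M) x || dominated (cover M) y) ->
  maximal_induced_matching M.
Proof.
move=> iM dom; apply/maxsetP; split=> // N /induced_matchingP[sN h] sMN.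
apply/eqP; rewrite eqEsubset sMN andbT; apply/subsetP => e eN.
have /edgesP[x [y [xy de]]] := subsetP sN _ eN.
suff: dominated (cover M) x || dominated (cover M) y -> e \in M by apply; exact: dom.
have step t : t \in e -> dominated (cover M) t -> e \in M.
  move=> te /exists_inP[z /bigcupP[f fM zf] zt].
  by rewrite -(h f e z t (subsetP sMN _ fM) eN zf te zt).
by case/orP; apply: step; rewrite de !inE eqxx ?orbT.
Qed.

(** The hypothesis says that [W] induces a subgraph of maximum degree at most 1. This reduces the
    construction of an induced matching to the choice of a vertex set. *)
Lemma induced_matching_restrict W :
  {in W & &, forall x y z, adj x y -> adj x z -> y = z} ->
  induced_matching [set e in edges H | e \subset W].
Proof.
move=> hW; apply/induced_matchingP; split.
  by apply/subsetP => e; rewrite inE => /andP[].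
move=> e1 e2 x y; rewrite 2!inE => /andP[e1E e1W] /andP[e2E e2W] xe ye.
have nbr (e : {set H}) z : e \in edges H -> e \subset W -> z \in e ->
    exists2 t, t \in W & adj z t /\ e = [set z; t].
  move=> /edgesP[p [q [pq ->]]]; rewrite subUset !sub1set => /andP[pW qW].
  rewrite !inE => /orP[] /eqP->; first by exists q.
  by exists p; rewrite // setUC adj_sym.
have xW := subsetP e1W _ xe; have yW := subsetP e2W _ ye.
have [p pW [xp ->]] := nbr _ _ e1E e1W xe.
have [q qW [yq ->]] := nbr _ _ e2E e2W ye.
case/orP=> [/eqP xy|xy]; first by subst y; rewrite (hW x p q).
rewrite (hW x p y) // (hW y q x) ?(adj_sym y) //; last by rewrite -adj_sym.
by rewrite setUC.
Qed.

Lemma cover_restrict W x y : x \in W -> y \in W -> adj x y ->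
  x \in cover [set e in edges H | e \subset W].
Proof.
move=> xW yW xy; apply/bigcupP; exists [set x; y]; last by rewrite !inE eqxx.
by rewrite inE mem_edges // subUset !sub1set xW.
Qed.

(** Two vertices of [S] cannot lie on one edge, so sending each to an edge of [M] through it is
    injective. *)
Lemma independent_cover_leq M S : M \subset edges H -> independent S ->
  S \subset cover M -> #|S| <= #|M|.
Proof.
move=> sM /independentP iS sS.
(* The default [set0] is never reached on [S], which [M] covers. *)
pose f x := odflt set0 [pick e in M | x \in e].
have fP x : x \in S -> f x \in M /\ x \in f x.
  move=> xS; rewrite /f; case: pickP => [e /andP[] //|no].
  by have /bigcupP[e eM xe] := subsetP sS _ xS; have := no e; rewrite eM xe.
rewrite -(card_in_imset (f := f)).
  by apply/subset_leq_card/subsetP => _ /imsetP[x xS ->]; case: (fP x xS).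
move=> x y xS yS fxy; apply/eqP; apply: contraT => nxy.
have [fM xf] := fP x xS; have [_] := fP y yS; rewrite -fxy => yf.
have [xy _] := edge_adj (subsetP sM _ fM) xf yf nxy.
by have := iS x y xS yS; rewrite xy.
Qed.

(** The edges of [M] are pairwise disjoint, so choosing a vertex of [S] on each is injective. *)
Lemma induced_matching_leq M S : induced_matching M ->
  (forall e, e \in M -> exists2 x, x \in e & x \in S) -> #|M| <= #|S|.
Proof.
move=> /induced_matchingP[_ h] hit.
pose f (e : {set H}) := [pick x in e :&: S].
have fP e : e \in M -> exists2 x, f e = Some x & (x \in e) && (x \in S).
  move=> eM; rewrite /f; case: pickP => [x|no]; first by rewrite inE; exists x.
  by have [x xe xS] := hit e eM; have := no x; rewrite inE xe xS.
rewrite -(card_in_imset (f := f)); last first.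
  move=> e1 e2 e1M e2M fe.
  have [x f1 /andP[x1 _]] := fP _ e1M; have [y f2 /andP[y2 _]] := fP _ e2M.
  apply: (h _ _ x y) => //; apply/orP; left; apply/eqP.
  by apply: Some_inj; rewrite -f1 -f2.
rewrite -(card_imset (mem S) Some_inj); apply/subset_leq_card/subsetP.
move=> _ /imsetP[e eM ->]; have [x -> /andP[_ xS]] := fP _ eM; exact: imset_f.
Qed.

Lemma leq_sigma k :
  (forall M, maximal_induced_matching M -> k <= #|M|) -> k <= sigma H.
Proof.
by rewrite /sigma; case: ex_minnP => _ /existsP[M /andP[mM /eqP<-]] _; apply.
Qed.

Lemma sigma_leq M : maximal_induced_matching M -> sigma H <= #|M|.
Proof.
rewrite /sigma; case: ex_minnP => m _ minm mM; apply: minm.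
by apply/existsP; exists M; rewrite mM eqxx.
Qed.

Lemma independent_leq_alpha S : independent S -> #|S| <= alpha H.
Proof. by move=> iS; apply: (bigmax_sup S). Qed.

Lemma alpha_attained : exists2 S : {set H}, independent S & alpha H = #|S|.
Proof.
have i0 : independent (set0 : {set H}) by apply/independentP => x; rewrite inE.
have [|S iS aS] := @eq_bigmax_cond _ (@independent H) (fun S => #|S|).
  by apply/card_gt0P; exists set0.
by exists S.
Qed.

End InducedMatchings.

(** * The gadgets of [T_graph G] *)

Section Gadgets.
Variable G : sgraph.
Local Notation TG := (T_graph G).
Local Notation tv v := (Tv v : vertex TG).
Local Notation ta v := (Ta v : vertex TG).
Local Notation tb v := (Tb v : vertex TG).
Local Notation tc v := (Tc v : vertex TG).
Local Notation td v i := (Td v i : vertex TG).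
Local Notation te v i := (Te v i : vertex TG).

(* One vertex of each edge of a small maximal induced matching, where [I] is
   the set of the [v] matched to [c^v]. *)
Definition representatives (I : {set G}) : {set TG} :=
  [set tc v | v in G] :|: [set tb v | v in ~: I].

Lemma representatives_c (I : {set G}) v : tc v \in representatives I.
Proof. by rewrite inE imset_f. Qed.

Lemma representatives_b (I : {set G}) v :
  v \notin I -> tb v \in representatives I.
Proof. by move=> vI; rewrite inE (imset_f (fun v => tb v)) ?orbT // inE. Qed.

Lemma card_representatives (I : {set G}) :
  #|representatives I| = 2 * #|G| - #|I|.
Proof.
rewrite cardsU (_ : _ :&: _ = set0) ?cards0 ?subn0; last first.
  by apply/setP => x; rewrite !inE; apply/andP => -[/imsetP[v _ ->] /imsetP[]].
rewrite card_imset; last by move=> u v [].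
rewrite card_imset; last by move=> u v [].
by rewrite cardsCs setCK mul2n -addnn addnBA // max_card.
Qed.

Lemma independent_representatives (I : {set G}) :
  independent (representatives I).
Proof.
by apply/independentP => x y; rewrite !inE;
   case/orP=> /imsetP[u _ ->]; case/orP=> /imsetP[v _ ->].
Qed.

(** The edge [d^v_i e^v_i] must have a dominated end, so, [c^v] being uncovered, [d^v_i] or [e^v_i]
    is covered. If [d^v_i] is, its partner can only be [e^v_i]. *)
Lemma cover_te (M : {set {set TG}}) v i : maximal_induced_matching M ->
  tc v \notin cover M -> te v i \in cover M.
Proof.
move=> mM /negPf ncv.
have sM : M \subset edges TG by have [/induced_matchingP[]] := maxsetP mM.
have d_e : td v i \in cover M -> te v i \in cover M.
  move=> dM; have [y] := cover_neighbour sM dM.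
  case: y => [u|u|u|u|u j|u j] //; rewrite /= /T_adj /= ?orbF.
    by move=> /eqP->; rewrite ncv.
  by move=> /andP[/eqP<- /eqP<-].
have de : adj (td v i) (te v i) by rewrite /= /T_adj /= !eqxx.
case/orP: (maximal_dominating mM de) => /exists_inP[z zM /orP[/eqP zE|]].
- by apply: d_e; rewrite -zE.
- case: z zM => [u|u|u|u|u j|u j] //; rewrite /= /T_adj /= ?orbF => zM.
    by move=> /eqP uv; rewrite uv ncv in zM.
  by move=> /andP[/eqP-> /eqP->].
- by rewrite -zE.
- case: z zM => [u|u|u|u|u j|u j] //; rewrite /= /T_adj /= ?orbF => zM.
  by move=> /andP[/eqP uv /eqP ij]; apply: d_e; rewrite -uv -ij.
Qed.

(** Same argument as for [cover_te], on the path [v], [a^v], [b^v]. *)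
Lemma cover_tb (M : {set {set TG}}) v : maximal_induced_matching M ->
  tv v \notin cover M -> tb v \in cover M.
Proof.
move=> mM /negPf ncv.
have sM : M \subset edges TG by have [/induced_matchingP[]] := maxsetP mM.
have a_b : ta v \in cover M -> tb v \in cover M.
  move=> aM; have [y] := cover_neighbour sM aM.
  case: y => [u|u|u|u|u j|u j] //; rewrite /= /T_adj /= ?orbF.
    by move=> /eqP->; rewrite ncv.
  by move=> /eqP<-.
have ab : adj (ta v) (tb v) by rewrite /= /T_adj /= eqxx.
case/orP: (maximal_dominating mM ab) => /exists_inP[z zM /orP[/eqP zE|]].
- by apply: a_b; rewrite -zE.
- case: z zM => [u|u|u|u|u j|u j] //; rewrite /= /T_adj /= ?orbF => zM.
    by move=> /eqP uv; rewrite uv ncv in zM.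
  by move=> /eqP->.
- by rewrite -zE.
- case: z zM => [u|u|u|u|u j|u j] //; rewrite /= /T_adj /= ?orbF => zM.
  by move=> /eqP uv; apply: a_b; rewrite -uv.
Qed.

Lemma leq_maximal_induced_matching (M : {set {set TG}}) :
  maximal_induced_matching M -> 2 * #|G| - alpha G <= #|M|.
Proof.
move=> mM; have [iM _] := maxsetP mM; have [sM hM] := induced_matchingP _ iM.
have [/forallP coverc|/forallPn[v ncv]] :=
    boolP [forall v : G, tc v \in cover M]; last first.
  (* An uncovered [c^v] forces all the [2n + 1] independent vertices [e^v_i] to be covered, hence
     more than [2n] edges. *)
  have: #|[set te v i | i in 'I_(2 * #|G| + 1)]| <= #|M|.
    apply: independent_cover_leq => //.
      by apply/independentP => _ _ /imsetP[i _ ->] /imsetP[j _ ->].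
    by apply/subsetP => _ /imsetP[i _ ->]; apply: cover_te.
  rewrite card_imset; last by move=> i j [].
  by rewrite card_ord addn1 => /ltnW; apply: leq_trans; rewrite leq_subr.
pose I := [set v | tv v \in cover M].
have indI : independent I.
  (* If [u] and [v] are adjacent and covered, then [M] contains both [uv] and [u c^u], two distinct
     edges through [u]. *)
  apply/independentP => u v; rewrite !inE => uM vM; apply/negP => uv.
  have tuv : adj (tv u) (tv v) by rewrite /= /T_adj /= uv.
  have uvM := induced_matching_edge iM uM vM tuv.
  have uc : adj (tv u) (tc u) by rewrite /= /T_adj /= eqxx.
  have ucM := induced_matching_edge iM uM (coverc u) uc.
  have E : [set tv u; tv v] = [set tv u; tc u].
    by apply: hM uvM ucM (set21 _ _) (set21 _ _) _; rewrite eqxx.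
  have := set22 (tv u) (tc u); rewrite -E !inE.
  by case/orP=> /eqP.
have: #|representatives I| <= #|M|.
  apply: independent_cover_leq => //; first exact: independent_representatives.
  apply/subsetP => x; rewrite inE => /orP[] /imsetP[v vI ->] //.
  by apply: cover_tb; rewrite // !inE in vI *.
apply: leq_trans.
by rewrite card_representatives leq_sub2l // independent_leq_alpha.
Qed.

(** * A small maximal induced matching built from an independent set *)

Lemma index0_subproof : 0 < 2 * #|G| + 1.
Proof. by rewrite addn1. Qed.

Definition index0 := Ordinal index0_subproof.

(** For independent [I], this set induces a perfect matching: [v c^v] when [v] is in [I], and
    otherwise [a^v b^v] together with one edge [c^v d^v_i], for the arbitrary choice
    [i = index0]. *)
Definition matched (I : {set G}) : {set TG} :=
  [set x : TG | match x : T_vertex G with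
                | Tv v => v \in I
                | Ta v | Tb v => v \notin I
                | Tc _ => true
                | Td v i => (v \notin I) && (i == index0)
                | Te _ _ => false
                end].

Definition matching_of (I : {set G}) : {set {set TG}} :=
  [set e in edges TG | e \subset matched I].

(** The partner in that perfect matching; values outside [matched I], such as those on [Te], are
    arbitrary. *)
Definition mate (I : {set G}) (x : TG) : TG :=
  match x : T_vertex G with
  | Tv v => tc v
  | Ta v => tb v
  | Tb v => ta v
  | Tc v => if v \in I then tv v else td v index0
  | Td v _ | Te v _ => tc v
  end.

Lemma mate_matched (I : {set G}) x :
  x \in matched I -> mate I x \in matched I /\ adj x (mate I x).
Proof.
case: x => [u|u|u|u|u i|u i]; rewrite inE //=; try by rewrite inE /T_adj /= ?eqxx.
by case: ifPn => uI; rewrite inE /T_adj /= ?uI ?eqxx.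
Qed.

Lemma matched_adj (I : {set G}) x y : independent I ->
  x \in matched I -> y \in matched I -> adj x y -> y = mate I x.
Proof.
move=> /independentP indI.
case: x => [u|u|u|u|u i|u i]; case: y => [v|v|v|v|v j|v j];
  rewrite 2!inE // /= /T_adj /= ?orbF ?orFb //.
(* Two original vertices in [matched I] both lie in [I]: independence excludes an edge between
   them. *)
- by move=> uI vI; have := indI u v uI vI; rewrite adj_sym orbb => /negPf->.
- by move=> uI vI /eqP uv; rewrite -uv uI in vI.
- by move=> _ _ /eqP->.
- by move=> uI vI /eqP uv; rewrite -uv vI in uI.
- by move=> _ _ /eqP->.
- by move=> _ _ /eqP->.
- by move=> _ vI /eqP<-; rewrite vI.
- by move=> _ /andP[/negPf vI /eqP->] /eqP->; rewrite vI.
- by move=> _ _ /eqP->.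
Qed.

Lemma induced_matching_of (I : {set G}) :
  independent I -> induced_matching (matching_of I).
Proof.
move=> indI; apply: induced_matching_restrict => x y z xW yW zW xy xz.
by rewrite (matched_adj indI xW yW xy) (matched_adj indI xW zW xz).
Qed.

Lemma cover_matching_of (I : {set G}) x :
  x \in matched I -> x \in cover (matching_of I).
Proof.
move=> xW; have [mW xm] := mate_matched xW.
exact: cover_restrict xW mW xm.
Qed.

(** Every [c^v] is covered and dominates [v], itself and all [d^v_i]; [a^v] is covered or dominated
    by [v]. The remaining vertices [b^v] and [e^v_i] are pairwise nonadjacent, so every edge has a
    dominated end. *)
Lemma maximal_matching_of (I : {set G}) :
  independent I -> maximal_induced_matching (matching_of I).
Proof.
move=> indI; apply: dominating_maximal; first exact: induced_matching_of.
have dom (z x : TG) : z \in matched I -> (z == x) || adj z x ->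
    dominated (cover (matching_of I)) x.
  by move=> zW; apply: dominatedI; apply: cover_matching_of.
have domv v : dominated (cover (matching_of I)) (tv v).
  by apply: (dom (tc v)); rewrite ?inE //= /T_adj /= eqxx.
have doma v : dominated (cover (matching_of I)) (ta v).
  have [vI|vI] := boolP (v \in I).
    by apply: (dom (tv v)); rewrite ?inE //= /T_adj /= eqxx.
  by apply: (dom (ta v)); rewrite ?inE ?eqxx.
have domc v : dominated (cover (matching_of I)) (tc v).
  by apply: (dom (tc v)); rewrite ?inE ?eqxx.
have domd v i : dominated (cover (matching_of I)) (td v i).
  by apply: (dom (tc v)); rewrite ?inE //= /T_adj /= eqxx.
by case=> [u|u|u|u|u i|u i]; case=> [v|v|v|v|v j|v j];
   rewrite ?domv ?doma ?domc ?domd ?orbT.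
Qed.

Lemma card_matching_of (I : {set G}) :
  independent I -> #|matching_of I| <= 2 * #|G| - #|I|.
Proof.
move=> indI; rewrite -card_representatives.
apply: induced_matching_leq; first exact: induced_matching_of.
move=> e; rewrite inE => /andP[/edgesP[x [y [xy ->]]]].
rewrite subUset !sub1set => /andP[xW yW].
have yE := matched_adj indI xW yW xy.
(* The edge joins [x] to its mate, so it contains some [c^u], or is [a^u b^u] with [u] outside
   [I]. *)
suff: (x \in representatives I) || (y \in representatives I).
  by case/orP=> ?; [exists x | exists y]; rewrite // !inE eqxx ?orbT.
move: yE xW => -> {y xy yW}.
case: x => [u|u|u|u|u i|u i]; rewrite inE //= => uI.
- by rewrite representatives_c orbT.
- by rewrite (representatives_b uI) orbT.
- by rewrite (representatives_b uI).
- by rewrite representatives_c.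
- by rewrite representatives_c orbT.
Qed.

End Gadgets.

Theorem theorem7 (G : sgraph) : sigma (T_graph G) = 2 * #|G| - alpha G.
Proof.
apply/eqP; rewrite eqn_leq; apply/andP; split.
  (* A maximum independent set gives the smallest of the bounds [2n - |I|]. *)
  have [I indI ->] := alpha_attained G.
  exact: leq_trans (sigma_leq (maximal_matching_of indI)) (card_matching_of indI).
by apply: leq_sigma => M; apply: leq_maximal_induced_matching.
Qed.
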